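(* Let $\mathsf{CPO}$ be the category of complete partial orders and continuous maps, let $\blacktriangleright=(-)_\bot$ be the lifting functor with point $p_X:X\to X_\bot$ the embedding, and for continuous $f:X_\bot\times Y\to X$ let $f^\dagger=f\cdot\langle s,Y\rangle:Y\to X$, where $s$ is the least fixpoint of the continuous map $\Phi_f:\mathsf{CPO}(Y,X_\bot)\to\mathsf{CPO}(Y,X_\bot)$, $\Phi_f(m)=p_X\cdot f\cdot\langle m,Y\rangle$. Then $(\mathsf{CPO},(-)_\bot,\dagger)$ satisfies the fixpoint identity, the parameter identity (P), the composition identity (C), the double dagger identity ($\dagger\dagger$) and uniformity (U).
   Context: $\mathsf{CPO}$: objects are partially ordered sets (possibly without a least element) having joins of $\omega$-chains; morphisms are maps preserving joins of $\omega$-chains. $X_\bot$ is $X$ with a newly added least element $\bot$. Hom-sets carry the pointwise order. Objects also denote their identity morphisms; $g\cdot f$ is composition ($f$ first); $\Delta$ is the diagonal. With $\blacktriangleright=(-)_\bot$, the properties are: (fixpoint identity) $f^\dagger=f\cdot(p_X\times Y)\cdot\langle f^\dagger,Y\rangle$ for all $f:\blacktriangleright X\times Y\to X$. (P) $f^\dagger\cdot h=(f\cdot(\blacktriangleright X\times h))^\dagger$ for all $f:\blacktriangleright X\times Y\to X$, $h:Z\to Y$. (C) $(g\cdot f)^\dagger=g\cdot(f\cdot(\blacktriangleright g\times Y))^\dagger$ for all $f:\blacktriangleright X\times Y\to Z$, $g:Z\to X$. ($\dagger\dagger$) $f^{\dagger\dagger}=(f\cdot(\Delta\times Y))^\dagger$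 for all $f:\blacktriangleright X\times\blacktriangleright X\times Y\to X$, where $f^\dagger:\blacktriangleright X\times Y\to X$ is taken with respect to the first component and $f^{\dagger\dagger}=(f^\dagger)^\dagger$. (U) for all $f:\blacktriangleright X\times Y\to X$, $g:\blacktriangleright X'\times Y\to X'$, $h:X\to X'$: if $h\cdot f=g\cdot(\blacktriangleright h\times Y)$ then $h\cdot f^\dagger=g^\dagger$. *)

(* Defs.v *)
From Stdlib Require Import Relation_Definitions Classical ClassicalEpsilon
  FunctionalExtensionality Arith Lia.

Set Implicit Arguments.
Unset Strict Implicit.
Unset Printing Implicit Defensive.

Section Joins.
Variables (T : Type) (le : T -> T -> Prop).

Definition chain (c : nat -> T) : Prop := forall n, le (c n) (c (S n)).

Definition is_join (c : nat -> T) (x : T) : Prop :=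
  (forall n, le (c n) x) /\ (forall y, (forall n, le (c n) y) -> le x y).

End Joins.

(* No least element is required, and the carrier may be empty. *)
Record cpo : Type := Cpo {
  carrier :> Type;
  le : carrier -> carrier -> Prop;
  le_order : order carrier le;
  chain_complete : forall c, chain le c -> exists x, is_join le c x }.

Arguments le {_} _ _.

Lemma le_refl (X : cpo) (x : X) : le x x.
Proof. apply (ord_refl _ _ (le_order X)). Qed.

Lemma le_trans (X : cpo) (x y z : X) : le x y -> le y z -> le x z.
Proof. apply (ord_trans _ _ (le_order X)). Qed.

Lemma le_antisym (X : cpo) (x y : X) : le x y -> le y x -> x = y.
Proof. apply (ord_antisym _ _ (le_order X)). Qed.

(* Monotonicity follows, see [hom_mono]. *)
Definition continuous (X Y : cpo) (f : X -> Y) : Prop :=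
  forall c x, chain le c -> is_join le c x -> is_join le (fun n => f (c n)) (f x).

Record hom (X Y : cpo) : Type := Hom {
  hom_fun :> X -> Y;
  hom_cont : continuous hom_fun }.

Lemma hom_ext (X Y : cpo) (f g : hom X Y) : (forall x, f x = g x) -> f = g.
Proof.
destruct f as [f Hf], g as [g Hg]; simpl; intros E.
apply functional_extensionality in E; subst g.
now rewrite (proof_irrelevance _ Hf Hg).
Qed.

Lemma join_unique (X : cpo) (c : nat -> X) x y :
  is_join le c x -> is_join le c y -> x = y.
Proof. intros [H1 H2] [H3 H4]; apply le_antisym; auto. Qed.

Lemma join_const (X : cpo) (x : X) : is_join le (fun _ => x) x.
Proof. split; intros; [apply le_refl | now apply (H 0)]. Qed.

Lemma hom_mono (X Y : cpo) (f : hom X Y) (x y : X) : le x y -> le (f x) (f y).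
Proof.
intros H.
set (c := fun n => match n with 0 => x | S _ => y end).
assert (Hc : chain le c) by (intros [|n]; [exact H | apply le_refl]).
assert (Hj : is_join le c y).
{ split; [intros [|n]; [exact H | apply le_refl] | intros z Hz; exact (Hz 1)]. }
exact (proj1 (hom_cont f Hc Hj) 0).
Qed.

Lemma hom_chain (X Y : cpo) (f : hom X Y) (c : nat -> X) :
  chain le c -> chain le (fun n => f (c n)).
Proof. intros H n; apply hom_mono, H. Qed.

Lemma chain_le (X : cpo) (c : nat -> X) m n : chain le c -> m <= n -> le (c m) (c n).
Proof.
intros H; induction 1; [apply le_refl | eapply le_trans; [eassumption | apply H]].
Qed.

Lemma join_shift (X : cpo) (c : nat -> X) k x : chain le c ->
  is_join le (fun n => c (k + n)) x <-> is_join le c x.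
Proof.
intros H; split; intros [H1 H2]; split.
- intros n; eapply le_trans; [| apply (H1 n)]; apply chain_le; auto; lia.
- intros y Hy; apply H2; intros n; apply Hy.
- intros n; apply H1.
- intros y Hy; apply H2; intros n; eapply le_trans; [| apply (Hy n)].
  apply chain_le; auto; lia.
Qed.

Lemma idmap_cont (X : cpo) : continuous (fun x : X => x).
Proof. intros c x _ H; exact H. Qed.

Definition idmap (X : cpo) : hom X X := Hom (@idmap_cont X).

Lemma comp_cont (X Y Z : cpo) (g : hom Y Z) (f : hom X Y) :
  continuous (fun x => g (f x)).
Proof. intros c x Hc Hx; apply hom_cont; [now apply hom_chain | now apply hom_cont]. Qed.

Definition comp (X Y Z : cpo) (g : hom Y Z) (f : hom X Y) : hom X Z :=
  Hom (comp_cont g f).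

Section Product.
Variables X Y : cpo.

Definition prod_le (u v : X * Y) : Prop := le (fst u) (fst v) /\ le (snd u) (snd v).

Lemma prod_le_order : order (X * Y) prod_le.
Proof.
split.
- intros u; split; apply le_refl.
- intros u v w [? ?] [? ?]; split; eapply le_trans; eassumption.
- intros [u1 u2] [v1 v2] [? ?] [? ?]; simpl in *; f_equal; now apply le_antisym.
Qed.

Lemma prod_joinI (c : nat -> X * Y) x y :
  is_join le (fun n => fst (c n)) x -> is_join le (fun n => snd (c n)) y ->
  is_join prod_le c (x, y).
Proof.
intros [H1 H2] [H3 H4]; split; [split; simpl; auto |].
intros z Hz; split; [apply H2 | apply H4]; intros n; apply Hz.
Qed.

Lemma prod_complete (c : nat -> X * Y) :
  chain prod_le c -> exists u, is_join prod_le c u.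
Proof.
intros H.
destruct (@chain_complete X (fun n => fst (c n))) as [x Hx]; [intros n; apply H |].
destruct (@chain_complete Y (fun n => snd (c n))) as [y Hy]; [intros n; apply H |].
exists (x, y); now apply prod_joinI.
Qed.

Definition prod_cpo : cpo := Cpo prod_le_order prod_complete.

Lemma proj1_cont : @continuous prod_cpo X fst.
Proof.
intros c u _ [H1 H2]; split; [intros n; apply H1 |].
intros x Hx; apply (H2 (x, snd u)); intros n; split; [apply Hx | apply H1].
Qed.

Lemma proj2_cont : @continuous prod_cpo Y snd.
Proof.
intros c u _ [H1 H2]; split; [intros n; apply H1 |].
intros y Hy; apply (H2 (fst u, y)); intros n; split; [apply H1 | apply Hy].
Qed.

Definition proj1 : hom prod_cpo X := Hom proj1_cont.
Definition proj2 : hom prod_cpo Y := Hom proj2_cont.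

End Product.

Lemma pairing_cont (X Y Z : cpo) (f : hom Z X) (g : hom Z Y) :
  @continuous Z (prod_cpo X Y) (fun z => (f z, g z)).
Proof.
intros c z Hc Hz; apply prod_joinI; simpl; now apply hom_cont.
Qed.

Definition pairing (X Y Z : cpo) (f : hom Z X) (g : hom Z Y) : hom Z (prod_cpo X Y) :=
  Hom (pairing_cont f g).

Definition prod_map (X X' Y Y' : cpo) (f : hom X X') (g : hom Y Y') :
    hom (prod_cpo X Y) (prod_cpo X' Y') :=
  pairing (comp f (proj1 X Y)) (comp g (proj2 X Y)).

Definition diag (X : cpo) : hom X (prod_cpo X X) := pairing (idmap X) (idmap X).

Definition assoc (X Y Z : cpo) : hom (prod_cpo (prod_cpo X Y) Z) (prod_cpo X (prod_cpo Y Z)) :=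
  pairing (comp (proj1 X Y) (proj1 (prod_cpo X Y) Z))
       (pairing (comp (proj2 X Y) (proj1 (prod_cpo X Y) Z)) (proj2 (prod_cpo X Y) Z)).

Section Lifting.
Variable X : cpo.

(* [None] is the new least element. *)
Definition lift_le (u v : option X) : Prop :=
  match u, v with
  | None, _ => True
  | Some _, None => False
  | Some x, Some y => le x y
  end.

Lemma lift_le_order : order (option X) lift_le.
Proof.
split.
- intros [x|]; simpl; auto using le_refl.
- intros [x|] [y|] [z|]; simpl; try tauto; apply le_trans.
- intros [x|] [y|]; simpl; try tauto; intros; f_equal; now apply le_antisym.
Qed.

Lemma lift_chain_cases (c : nat -> option X) : chain lift_le c ->
  (forall n, c n = None) \/
  exists k (d : nat -> X), chain le d /\ forall n, c (k + n) = Some (d n).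
Proof.
intros H.
destruct (classic (exists k, c k <> None)) as [[k Hk] | Hn].
- right; exists k.
  assert (Hs : forall n, {x | c (k + n) = Some x}).
  { induction n as [|n [x IH]].
    - rewrite Nat.add_0_r; destruct (c k) as [x|]; [now exists x | now destruct Hk].
    - specialize (H (k + n)); rewrite Nat.add_succ_r; rewrite IH in H.
      destruct (c (S (k + n))) as [y|]; [now exists y | destruct H]. }
  exists (fun n => proj1_sig (Hs n)); split; [| intros n; now destruct (Hs n)].
  intros n; specialize (H (k + n)).
  destruct (Hs n) as [x Ex], (Hs (S n)) as [y Ey]; simpl.
  rewrite Nat.add_succ_r in Ey; now rewrite Ex, Ey in H.
- left; intros n; apply NNPP; intros E; apply Hn; now exists n.
Qed.

Lemma lift_joinI (c : nat -> option X) k (d : nat -> X) x : chain lift_le c ->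
  (forall n, c (k + n) = Some (d n)) -> is_join le d x -> is_join lift_le c (Some x).
Proof.
intros Hc E [H1 H2]; split.
- assert (M : forall m n, m <= n -> lift_le (c m) (c n)).
  { induction 1; [apply lift_le_order |].
    eapply (ord_trans _ _ lift_le_order); [eassumption | apply Hc]. }
  intros n; apply (ord_trans _ _ lift_le_order) with (c (k + n)); [apply M; lia |].
  rewrite E; apply H1.
- intros [y|] Hy.
  + apply H2; intros n; specialize (Hy (k + n)); now rewrite E in Hy.
  + specialize (Hy (k + 0)); now rewrite E in Hy.
Qed.

Lemma lift_complete (c : nat -> option X) :
  chain lift_le c -> exists u, is_join lift_le c u.
Proof.
intros H; destruct (lift_chain_cases H) as [E | (k & d & Hd & E)].
- exists None; split; [| intros; exact I].
  intros n; now rewrite E.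
- destruct (chain_complete Hd) as [x Hx]; exists (Some x).
  now apply lift_joinI with k d.
Qed.

Definition lift : cpo := Cpo lift_le_order lift_complete.

Lemma point_cont : @continuous X lift (@Some X).
Proof.
intros c x Hc Hx; now apply (@lift_joinI (fun n => Some (c n)) 0 c).
Qed.

Definition point : hom X lift := Hom point_cont.

End Lifting.

Lemma lift_map_cont (X Y : cpo) (h : hom X Y) :
  @continuous (lift X) (lift Y) (option_map h).
Proof.
intros c u Hc Hu.
assert (Hc' : chain (@lift_le Y) (fun n => option_map h (c n))).
{ intros n; specialize (Hc n); simpl in Hc.
  destruct (c n), (c (S n)); simpl in *; auto; now apply hom_mono. }
destruct (lift_chain_cases Hc) as [E | (k & d & Hd & E)].
- replace u with (@None X).
  + split; [| intros; exact I].
    intros n; now rewrite E.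
  + apply (@join_unique (lift X) c); [| exact Hu].
    split; [| intros; exact I].
    intros n; now rewrite E.
- destruct (chain_complete Hd) as [x Hx].
  replace u with (Some x).
  + apply lift_joinI with k (fun n => h (d n)); auto.
    * intros n; now rewrite E.
    * now apply hom_cont.
  + apply (@join_unique (lift X) c); [| exact Hu].
    now apply lift_joinI with k d.
Qed.

Definition lift_map (X Y : cpo) (h : hom X Y) : hom (lift X) (lift Y) :=
  Hom (lift_map_cont h).

Lemma lift_map_id (X : cpo) : lift_map (idmap X) = idmap (lift X).
Proof. now apply hom_ext; intros [x|]. Qed.

Lemma lift_map_comp (X Y Z : cpo) (g : hom Y Z) (f : hom X Y) :
  lift_map (comp g f) = comp (lift_map g) (lift_map f).
Proof. now apply hom_ext; intros [x|]. Qed.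

Lemma point_natural (X Y : cpo) (h : hom X Y) :
  comp (lift_map h) (point X) = comp (point Y) h.
Proof. now apply hom_ext. Qed.

Section HomCpo.
Variables X Y : cpo.

Definition hom_le (f g : hom X Y) : Prop := forall x, le (f x) (g x).

Lemma hom_le_order : order (hom X Y) hom_le.
Proof.
split.
- intros f x; apply le_refl.
- intros f g h H1 H2 x; eapply le_trans; [apply H1 | apply H2].
- intros f g H1 H2; apply hom_ext; intros x; now apply le_antisym.
Qed.

Lemma hom_joinI (c : nat -> hom X Y) (f : hom X Y) :
  (forall x, is_join le (fun n => c n x) (f x)) -> is_join hom_le c f.
Proof.
intros H; split; [intros n x; now apply (H x) |].
intros g Hg x; apply (H x); intros n; apply Hg.
Qed.

Lemma hom_pointwise_join (c : nat -> hom X Y) : chain hom_le c ->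
  exists f : hom X Y, forall x, is_join le (fun n => c n x) (f x).
Proof.
intros Hc.
assert (J : forall x, {y | is_join le (fun n => c n x) y}).
{ intros x; apply constructive_indefinite_description, chain_complete.
  intros n; apply Hc. }
assert (C : continuous (fun x => proj1_sig (J x))).
{ intros d x Hd Hx; split.
  - intros m; apply (proj2_sig (J (d m))); intros n.
    apply le_trans with (c n x); [| apply (proj2_sig (J x))].
    apply hom_mono, Hx.
  - intros z Hz; apply (proj2_sig (J x)); intros n.
    apply (hom_cont (c n) Hd Hx); intros m.
    apply le_trans with (proj1_sig (J (d m))); [| apply (Hz m)].
    apply (proj2_sig (J (d m))). }
exists (Hom C); intros x; exact (proj2_sig (J x)).
Qed.

Lemma hom_complete (c : nat -> hom X Y) :
  chain hom_le c -> exists f, is_join hom_le c f.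
Proof.
intros Hc; destruct (hom_pointwise_join Hc) as [f Hf].
exists f; now apply hom_joinI.
Qed.

Definition hom_cpo : cpo := Cpo hom_le_order hom_complete.

Lemma hom_joinE (c : nat -> hom_cpo) (f : hom_cpo) : chain le c -> is_join le c f ->
  forall x, is_join le (fun n => c n x) (f x).
Proof.
intros Hc Hf; destruct (hom_pointwise_join Hc) as [g Hg].
replace f with g; [exact Hg |].
apply (@join_unique hom_cpo c); [now apply hom_joinI | exact Hf].
Qed.

End HomCpo.

Definition is_least_fixpoint (D : cpo) (F : hom D D) (s : D) : Prop :=
  F s = s /\ forall t, F t = t -> le s t.

Lemma least_fixpoint_exists (D : cpo) (bot : D) (F : hom D D) :
  (forall x, le bot x) -> exists s, is_least_fixpoint F s.
Proof.
intros Hbot.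
set (c := fun n => Nat.iter n F bot).
assert (Hc : chain le c) by (intros n; induction n; [apply Hbot | now apply hom_mono]).
destruct (chain_complete Hc) as [s Hs]; exists s; split.
- apply (@join_unique D (fun n => c (1 + n))).
  + exact (hom_cont F Hc Hs).
  + now apply join_shift.
- intros t Ht; apply Hs; intros n; induction n as [|n IH]; [apply Hbot |].
  rewrite <- Ht; now apply hom_mono.
Qed.

Section Dagger.
Variables (X Y : cpo) (f : hom (prod_cpo (lift X) Y) X).

Definition Phi_fun (m : hom_cpo Y (lift X)) : hom_cpo Y (lift X) :=
  comp (point X) (comp f (pairing m (idmap Y))).

Lemma Phi_cont : continuous Phi_fun.
Proof.
intros c m Hc Hm; apply hom_joinI; intros y; simpl.
apply (hom_cont (comp (point X) f) (c := fun n => (c n y, y))).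
- intros n; split; [apply Hc | apply le_refl].
- apply prod_joinI; simpl; [exact (hom_joinE Hc Hm y) | apply join_const].
Qed.

Definition Phi : hom (hom_cpo Y (lift X)) (hom_cpo Y (lift X)) := Hom Phi_cont.

Lemma Phi_least_fixpoint_exists : exists s, is_least_fixpoint Phi s.
Proof.
assert (C : @continuous Y (lift X) (fun _ => None)).
{ intros c y _ _; apply (@join_const (lift X)). }
now apply (@least_fixpoint_exists (hom_cpo Y (lift X)) (Hom C)).
Qed.

Definition Phi_lfp : hom Y (lift X) :=
  proj1_sig (constructive_indefinite_description _ Phi_least_fixpoint_exists).

Lemma Phi_lfpP : is_least_fixpoint Phi Phi_lfp.
Proof.
exact (proj2_sig (constructive_indefinite_description _ Phi_least_fixpoint_exists)).
Qed.

Definition dagger : hom Y X := comp f (pairing Phi_lfp (idmap Y)).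

End Dagger.

Declare Scope cpo_scope.
Delimit Scope cpo_scope with cpo.
Notation "g ∘ f" := (comp g f) (at level 40, left associativity) : cpo_scope.
Notation "⟨ f , g ⟩" := (pairing f g) (at level 0) : cpo_scope.
Notation "X ⊗ Y" := (prod_cpo X Y) (at level 35, right associativity) : cpo_scope.
Notation "f ×× g" := (prod_map f g) (at level 35, right associativity) : cpo_scope.
Notation "f †" := (dagger f) (at level 5, left associativity) : cpo_scope.
Notation "▶ X" := (lift X) (at level 20, right associativity) : cpo_scope.

(* Main.v *)
(** The least fixpoint defining [f†] is the join of its Kleene chain, and this join is
    computed pointwise: [Some (f† y)] is the join of the iterates of [u ↦ Some (f (u, y))]
    from [None]. A map [h] intertwining [f] and [g] carries one Kleene chain to the other
    and, being continuous, one join to the other; this is uniformity. It yields (P) with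
    [h] the identity, and (C) with [h] equal to [g]. For the double dagger identity, both
    sides are fixpoints of [x ↦ f (Some x, Some x, y)] and each one is below the other
    because [f† y] lies below every prefixpoint. *)

Require Import Defs.

Open Scope cpo_scope.

(** By continuity the join of the Kleene chain is a fixpoint, since dropping the first term keeps
    the join; induction bounds the chain by [s]. *)
Lemma least_fixpoint_kleene (D : cpo) (bot : D) (F : hom D D) (s : D) :
  (forall x, le bot x) -> is_least_fixpoint F s ->
  chain le (fun n => Nat.iter n F bot) /\ is_join le (fun n => Nat.iter n F bot) s.
Proof.
intros Hbot [Hs Hleast].
assert (Hc : chain le (fun n => Nat.iter n F bot)).
{ intros n; induction n; [apply Hbot | now apply hom_mono]. }
split; [exact Hc |].
destruct (chain_complete Hc) as [t Ht].
assert (Ft : F t = t).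
{ apply (@join_unique D (fun n => Nat.iter (1 + n) F bot)).
  - exact (hom_cont F Hc Ht).
  - now apply (join_shift (c := fun n => Nat.iter n F bot)). }
replace s with t; [exact Ht |].
apply le_antisym; [| now apply Hleast].
apply Ht; intros n; induction n as [|n IH]; [apply Hbot |].
rewrite <- Hs; now apply hom_mono.
Qed.

Lemma le_eq {X : cpo} (x y : X) : x = y -> le x y.
Proof. intros ->; apply le_refl. Qed.

Definition kleene {X Y : cpo} (f : hom (▶ X ⊗ Y) X) (y : Y) (n : nat) : ▶ X :=
  Nat.iter n (fun u => Some (f (u, y))) None.

Lemma dagger_some {X Y : cpo} (f : hom (▶ X ⊗ Y) X) (y : Y) :
  Phi_lfp f y = Some (f † y).
Proof.
exact (eq_sym (f_equal (fun m : hom Y (▶ X) => m y) (Logic.proj1 (Phi_lfpP f)))).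
Qed.

(** Joins of chains of maps are pointwise, so the Kleene chain of [Phi f] may be evaluated at
    [y]. *)
Lemma dagger_kleene {X Y : cpo} (f : hom (▶ X ⊗ Y) X) (y : Y) :
  chain le (kleene f y) /\ is_join le (kleene f y) (Some (f † y) : ▶ X).
Proof.
assert (C : @continuous Y (▶ X) (fun _ => None)).
{ intros c z _ _; apply (@join_const (▶ X)). }
destruct (@least_fixpoint_kleene (hom_cpo Y (▶ X)) (Hom C) (Phi f) (Phi_lfp f))
  as [Hc Hj]; [now intros m z | apply Phi_lfpP |].
assert (E : forall n,
  kleene f y n = (Nat.iter n (Phi f) (Hom C : hom_cpo Y (▶ X)) : hom Y (▶ X)) y).
{ induction n as [|n IH]; [reflexivity |].
  change (kleene f y (S n)) with (Some (f (kleene f y n, y))).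
  rewrite IH; reflexivity. }
rewrite <- dagger_some.
destruct (hom_joinE Hc Hj y) as [Hub Hleast].
split; [| split].
- intros n; rewrite !E; apply Hc.
- intros n; rewrite E; apply Hub.
- intros v Hv; apply Hleast; intros n; rewrite <- E; apply Hv.
Qed.

Lemma dagger_fix {X Y : cpo} (f : hom (▶ X ⊗ Y) X) (y : Y) :
  f † y = f (Some (f † y), y).
Proof. rewrite <- dagger_some; reflexivity. Qed.

Lemma dagger_least {X Y : cpo} (f : hom (▶ X ⊗ Y) X) (y : Y) (x : X) :
  le (f (Some x, y)) x -> le (f † y) x.
Proof.
intros Hx.
apply (Logic.proj2 (Logic.proj2 (dagger_kleene f y)) (Some x)).
intros n; induction n as [|n IH]; [exact I |].
apply le_trans with (f (Some x, y)); [| exact Hx].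
apply (hom_mono f); split; [exact IH | apply le_refl].
Qed.

(* Allowing the parameters [y] and [z] to differ makes (P) an instance. *)
Lemma dagger_uniform {X X' Y Z : cpo} (f : hom (▶ X ⊗ Y) X) (g : hom (▶ X' ⊗ Z) X')
    (h : hom X X') (y : Y) (z : Z) :
  (forall u, h (f (u, y)) = g (lift_map h u, z)) -> h (f † y) = g † z.
Proof.
intros H.
(* The base case holds because [lift_map h] is strict. *)
assert (E : forall n, lift_map h (kleene f y n) = kleene g z n).
{ induction n as [|n IH]; [reflexivity |].
  change (Some (h (f (kleene f y n, y))) = Some (g (kleene g z n, z))).
  now rewrite H, IH. }
destruct (dagger_kleene f y) as [Hc Hj].
destruct (hom_cont (lift_map h) Hc Hj) as [Hub Hleast].
assert (S : @Some X' (h (f † y)) = Some (g † z)); [| now injection S].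
apply (@join_unique (▶ X') (kleene g z)); [| apply dagger_kleene].
split.
- intros n; rewrite <- E; apply Hub.
- intros v Hv; apply Hleast; intros n; rewrite E; apply Hv.
Qed.

Theorem theorem3p7 :
  (* fixpoint identity *)
  (forall (X Y : cpo) (f : hom (▶ X ⊗ Y) X),
     f † = f ∘ (point X ×× idmap Y) ∘ ⟨f †, idmap Y⟩) /\
  (* parameter identity (P) *)
  (forall (X Y Z : cpo) (f : hom (▶ X ⊗ Y) X) (h : hom Z Y),
     f † ∘ h = (f ∘ (idmap (▶ X) ×× h)) †) /\
  (* composition identity (C) *)
  (forall (X Y Z : cpo) (f : hom (▶ X ⊗ Y) Z) (g : hom Z X),
     (g ∘ f) † = g ∘ (f ∘ (lift_map g ×× idmap Y)) †) /\
  (* double dagger identity *)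
  (forall (X Y : cpo) (f : hom (▶ X ⊗ (▶ X ⊗ Y)) X),
     f † † = (f ∘ (assoc (▶ X) (▶ X) Y ∘ (diag (▶ X) ×× idmap Y))) †) /\
  (* uniformity (U) *)
  (forall (X X' Y : cpo) (f : hom (▶ X ⊗ Y) X) (g : hom (▶ X' ⊗ Y) X')
          (h : hom X X'),
     h ∘ f = g ∘ (lift_map h ×× idmap Y) -> h ∘ f † = g †).
Proof.
split; [| split; [| split; [| split]]].
- intros X Y f; apply hom_ext; intros y; apply dagger_fix.
- intros X Y Z f h; apply hom_ext; intros z; symmetry.
  apply (dagger_uniform (f ∘ (idmap (▶ X) ×× h)) f (idmap X)).
  intros u; now rewrite lift_map_id.
- intros X Y Z f g; apply hom_ext; intros y; symmetry.
  now apply (dagger_uniform (f ∘ (lift_map g ×× idmap Y)) (g ∘ f) g).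
- intros X Y f; apply hom_ext; intros y.
  set (k := f ∘ (assoc (▶ X) (▶ X) Y ∘ (diag (▶ X) ×× idmap Y))).
  pose proof (dagger_fix k y) as Ek.
  pose proof (dagger_fix f (Some (f † † y), y)) as Ef.
  (* Folding the inner dagger shows that [f † † y] is a fixpoint of [k] at [y]. *)
  rewrite <- (dagger_fix f † y) in Ef.
  apply le_antisym.
  (* First the outer dagger, then the inner one at [Some (k † y)]. *)
  + apply dagger_least, dagger_least.
    apply le_eq; exact (eq_sym Ek).
  + apply dagger_least.
    apply le_eq; exact (eq_sym Ef).
- intros X X' Y f g h H; apply hom_ext; intros y; apply dagger_uniform.
  intros u; exact (f_equal (fun m : hom (▶ X ⊗ Y) X' => m (u, y)) H).
Qed.
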